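(* Let $G$ be a simple connected graph with $n$ nodes and $m$ edges, let $q\ge1$ and $k\ge0$ be integers, and let $\mathcal K_{q,k}$, $\bar{\mathcal K}_{q,k}$ and $\hat{\mathcal K}_{q,k}$ denote the Kirchhoff index, additive degree-Kirchhoff index and multiplicative degree-Kirchhoff index of the iterated $q$-triangulation graph $R_{q,k}(G)$ (so the index $k=0$ gives the quantities of $G$). Then $$\begin{aligned}\mathcal K_{q,k}=&\Big(\frac{2}{q+2}\Big)^k\mathcal K_{q,0}\\ &+\Big[\Big(\frac{2(2q+1)^2}{q+2}\Big)^k-\Big(\frac{2}{q+2}\Big)^k\Big]\Big(\frac{\hat{\mathcal K}_{q,0}}{16}-\frac{m^2(q+2)}{12(2q+1)}-\frac{mn}{24}+\frac{m(q-1)}{24(2q+1)}\Big)\\ &+\Big[\Big(\frac{2(2q+1)}{q+2}\Big)^k-\Big(\frac{2}{q+2}\Big)^k\Big]\bigg(\frac{\bar{\mathcal K}_{q,0}}{4}-\frac{\hat{\mathcal K}_{q,0}}{8}-\frac{m^2(q+2)(2q-1)}{6(2q+1)(2q+5)}\\ &\qquad\qquad+\frac{m(2n(q-1)-q+4)}{12(2q+1)}-\frac{n(n-1)}{12}\bigg)\\ &+\Big[(2q+1)^{2k}-\Big(\frac{2}{q+2}\Big)^k\Big]\frac{m^2(2q+3)^2}{8(2q+1)(2q+5)}\\ &-\Big[(2q+1)^{k}-\Big(\frac{2}{q+2}\Big)^k\Big]\bigg(\frac{m(4q^2+12q+11)(m-2n)}{12(2q+1)(2q+5)}+\frac{m(4q^2+18q+23)}{12(2q+1)(2q+5)}\bigg)\\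 &+\Big[\Big(\frac{2}{q+2}\Big)^k-1\Big]\frac{(m-2n)(m-2n+2)}{24}.\end{aligned}$$
   Context: For a positive integer $q$, the $q$-triangulation graph $R_q(G)$ is obtained from $G$ by keeping all nodes and edges of $G$ and adding, for each edge $uv$ of $G$, $q$ disjoint paths of length $2$: $ux_1v,\dots,ux_qv$, where $x_1,\dots,x_q$ are new nodes. The iterated $q$-triangulation graphs are $R_{q,0}(G)=G$ and $R_{q,k}(G)=R_q(R_{q,k-1}(G))$ for $k\ge1$. The resistance distance $r_{ij}$ between nodes $i,j$ of a simple connected graph is the effective resistance between them when every edge is replaced by a unit resistor. With $d_i$ the degree of node $i$ and sums over unordered pairs of distinct nodes: the Kirchhoff index is $\mathcal K(G)=\sum_{\{i,j\}\subseteq V(G)}r_{ij}$, the additive degree-Kirchhoff index is $\bar{\mathcal K}(G)=\sum_{\{i,j\}\subseteq V(G)}(d_i+d_j)r_{ij}$, and the multiplicative degree-Kirchhoff index is $\hat{\mathcal K}(G)=\sum_{\{i,j\}\subseteq V(G)}d_id_jr_{ij}$. *)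

(* Defs.v *)
From HB Require Import structures.
From mathcomp Require Import all_boot all_order all_algebra.

Set Implicit Arguments.
Unset Strict Implicit.
Unset Printing Implicit Defensive.

Import Order.TTheory GRing.Theory Num.Theory.
Local Open Scope ring_scope.

Record sgraph := SGraph {
  vertex :> finType;
  adj : rel vertex;
  adj_sym : symmetric adj;
  adj_irr : irreflexive adj
}.

Definition connected (G : sgraph) : bool :=
  (0 < #|G|)%N && [forall x : G, forall y : G, connect (@adj G) x y].

Definition edges (G : sgraph) : {set {set G}} :=
  [set [set p.1; p.2] | p : G * G & adj p.1 p.2].

Definition degree (G : sgraph) (x : G) : nat := #|[set y | adj x y]|.

Section Triangulation.
Variables (q : nat) (G : sgraph).

(* [inr (e, i)] is the new node x_i on the i-th path added along the edge e. *)
Definition tri_vertex : finType :=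
  (G + {e : {set G} | e \in edges G} * 'I_q)%type.

Definition tri_adj : rel tri_vertex := fun a b =>
  match a, b with
  | inl x, inl y => adj x y
  | inl x, inr (e, _) => x \in val e
  | inr (e, _), inl x => x \in val e
  | inr _, inr _ => false
  end.

Lemma tri_adj_sym : symmetric tri_adj.
Proof. by move=> [x|[e i]] [y|[f j]] //=; apply: adj_sym. Qed.

Lemma tri_adj_irr : irreflexive tri_adj.
Proof. by move=> [x|[e i]] //=; apply: adj_irr. Qed.

Definition triangulation : sgraph := SGraph tri_adj_sym tri_adj_irr.

End Triangulation.

Definition iter_triangulation (q k : nat) (G : sgraph) : sgraph :=
  iter k (triangulation q) G.

Section Resistance.
Variables (R : realFieldType) (G : sgraph).

Definition laplacian : 'M[R]_#|G| :=
  \matrix_(i, j) ((degree (enum_val i))%:R *+ (i == j)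
                  - (adj (enum_val i) (enum_val j))%:R).

Definition unit_current (x y : G) : 'rV[R]_#|G| :=
  delta_mx 0 (enum_rank x) - delta_mx 0 (enum_rank y).

(* On a connected graph, this is a potential for which a unit current enters
   the network of unit resistors at x and leaves it at y; it is unique up to an
   additive constant. See [potentialP] and [resistanceP]. *)
Definition potential (x y : G) : 'rV[R]_#|G| :=
  unit_current x y *m pinvmx laplacian.

Definition resistance (x y : G) : R :=
  potential x y 0 (enum_rank x) - potential x y 0 (enum_rank y).

(* Comparing ranks in the enumeration of the nodes lists each unordered pair of
   distinct nodes exactly once; the summands below are symmetric. *)
Definition kirchhoff : R :=
  \sum_(p : G * G | (enum_rank p.1 < enum_rank p.2)%N) resistance p.1 p.2.

Definition add_degree_kirchhoff : R :=
  \sum_(p : G * G | (enum_rank p.1 < enum_rank p.2)%N)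
     ((degree p.1)%:R + (degree p.2)%:R) * resistance p.1 p.2.

Definition mul_degree_kirchhoff : R :=
  \sum_(p : G * G | (enum_rank p.1 < enum_rank p.2)%N)
     (degree p.1)%:R * (degree p.2)%:R * resistance p.1 p.2.

(* Kirchhoff's current law with unit resistors, current 1 in at x, out at y. *)
Definition unit_potential (x y : G) (v : G -> R) : Prop :=
  forall z, \sum_(w | adj z w) (v z - v w) = (z == x)%:R - (z == y)%:R.

Lemma lap_mul (u : 'rV[R]_#|G|) (z : G) :
  (u *m laplacian) 0 (enum_rank z) =
  \sum_(w | adj z w) (u 0 (enum_rank z) - u 0 (enum_rank w)).
Proof.
rewrite mxE (reindex (@enum_rank G)) /=; last first.
  by exists enum_val => i _; [apply: enum_rankK | apply: enum_valK].
rewrite sumrB sumr_const.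
under eq_bigr do rewrite mxE !enum_rankK mulrBr.
rewrite sumrB; congr (_ - _).
  rewrite (bigD1 z) //= eqxx mulr1n big1 ?addr0 => [|w wz].
    by rewrite mulr_natr /degree cardsE.
  by rewrite (inj_eq enum_rank_inj) (negbTE wz) mulr0n mulr0.
rewrite [RHS]big_mkcond /=; apply: eq_bigr => w _.
by rewrite adj_sym; case: ifP => _; rewrite ?mulr1 ?mulr0.
Qed.

Lemma harmonic_const (v : G -> R) : connected G ->
  (forall z, \sum_(w | adj z w) (v z - v w) = 0) -> forall a b, v a = v b.
Proof.
move=> /andP[_ /forallP cG] hv.
pose S := \sum_z \sum_(w | adj z w) (v z - v w) ^+ 2.
have S0 : S = 0.
  have h1 : \sum_z \sum_(w | adj z w) v z * (v z - v w) = 0.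
    by apply: big1 => z _; rewrite -mulr_sumr hv mulr0.
  have h2 : \sum_z \sum_(w | adj z w) v w * (v z - v w) = 0.
    rewrite (exchange_big_dep predT) //=; apply: big1 => w _.
    rewrite -mulr_sumr -[X in _ * X]opprK -sumrN.
    under eq_bigl do rewrite adj_sym.
    by under eq_bigr do rewrite opprB; rewrite hv oppr0 mulr0.
  transitivity (\sum_z \sum_(w | adj z w) v z * (v z - v w)
    - \sum_z \sum_(w | adj z w) v w * (v z - v w)); last by rewrite h1 h2 subr0.
  rewrite -sumrB; apply: eq_bigr => z _; rewrite -sumrB.
  by apply: eq_bigr => w _; rewrite -mulrBl expr2.
have step z w : adj z w -> v z = v w.
  move=> zw; apply/eqP; rewrite -subr_eq0 -sqrf_eq0.
  have inner z' : true -> 0 <= \sum_(w' | adj z' w') (v z' - v w') ^+ 2.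
    by move=> _; apply: sumr_ge0 => w' _; apply: sqr_ge0.
  have /eqP := S0; rewrite psumr_eq0 // => /allP /(_ z (mem_index_enum _)) /=.
  rewrite psumr_eq0 => [|w' _]; last exact: sqr_ge0.
  by move=> /allP /(_ w (mem_index_enum _)) /implyP /(_ zw).
move=> a b; have /forallP/(_ b)/connectP[p] := cG a.
elim: p a => [|c p IH] a /= => [_ -> //|/andP[ac cp] e].
by rewrite (step _ _ ac) (IH c).
Qed.

Lemma unit_current_sub (x y : G) : connected G ->
  (unit_current x y <= laplacian)%MS.
Proof.
move=> cG; pose o : 'cV[R]_#|G| := const_mx 1.
have cur0 : (unit_current x y <= kermx o)%MS.
  apply/sub_kermxP; apply/matrixP => i j; rewrite mulmxBl -!rowE !mxE.
  by rewrite subrr.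
have sLo : (laplacian <= kermx o)%MS.
  apply/sub_kermxP/matrixP => i j; rewrite !mxE.
  have symL : laplacian^T = laplacian.
    by apply/matrixP=> a b; rewrite !mxE adj_sym eq_sym; case: eqP => [->|].
  transitivity ((o^T *m laplacian) 0 i).
    rewrite mxE; apply: eq_bigr => a _.
    by rewrite -[in RHS]symL mulrC [X in _ = _ * X]mxE [in RHS]mxE !mxE.
  rewrite -[i]enum_valK lap_mul; apply: big1 => w _; by rewrite !mxE subrr.
apply: (submx_trans cur0).
rewrite -(geq_leqif (mxrank_leqif_sup sLo)) mxrank_ker.
have x0 := enum_rank x.
have ro : (0 < \rank o)%N.
  rewrite lt0n mxrank_eq0; apply/eqP => /matrixP /(_ x0 0).
  by rewrite !mxE => /eqP; rewrite oner_eq0.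
have kL : (\rank (kermx laplacian) <= 1)%N.
  have h : (kermx laplacian <= (o^T : 'rV_ _))%MS.
    apply/row_subP => i; set u := row i _.
    have uL : u *m laplacian = 0.
      by apply/sub_kermxP; apply: row_sub.
    have hz z : \sum_(w | adj z w) (u 0 (enum_rank z) - u 0 (enum_rank w)) = 0.
      by rewrite -lap_mul uL mxE.
    have cst := harmonic_const cG hz.
    suff -> : u = u 0 x0 *: o^T by apply: scalemx_sub.
    apply/rowP => j; rewrite [RHS]mxE [X in _ * X]mxE [X in _ * X]mxE mulr1.
    by rewrite -[j]enum_valK -[x0]enum_valK; apply: cst.
  by apply: (leq_trans (mxrankS h)); apply: rank_leq_row.
rewrite mxrank_ker leq_subLR addnC in kL.
by rewrite leq_subLR (leq_trans kL) // leq_add2r.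
Qed.

Lemma potentialP (x y : G) : connected G ->
  unit_potential x y (fun z => potential x y 0 (enum_rank z)).
Proof.
move=> cG z; rewrite -lap_mul mulmxKpV ?unit_current_sub // !mxE !eqxx /=.
by rewrite !(inj_eq enum_rank_inj).
Qed.

Lemma resistanceP (x y : G) (v : G -> R) : connected G ->
  unit_potential x y v -> resistance x y = v x - v y.
Proof.
move=> cG hv; have hp := potentialP x y cG.
pose d z := potential x y 0 (enum_rank z) - v z.
have hd z : \sum_(w | adj z w) (d z - d w) = 0.
  have -> : \sum_(w | adj z w) (d z - d w) =
      \sum_(w | adj z w) (potential x y 0 (enum_rank z)
                          - potential x y 0 (enum_rank w))
      - \sum_(w | adj z w) (v z - v w).
    by rewrite -sumrB; apply: eq_bigr => w _; rewrite /d !opprD addrACA.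
  by rewrite (hp z) (hv z) subrr.
have /eqP := harmonic_const cG hd x y.
by rewrite -subr_eq0 /d opprD addrACA -opprD subr_eq0 => /eqP.
Qed.

End Resistance.

(* Main.v *)
Require Import Defs.
From HB Require Import structures.
From mathcomp Require Import all_boot all_order all_algebra.
From mathcomp Require Import ring lra.

Set Implicit Arguments.
Unset Strict Implicit.
Unset Printing Implicit Defensive.

Import Order.TTheory GRing.Theory Num.Theory.
Local Open Scope ring_scope.

(** The whole computation rests on one reformulation of effective resistance:
    on a connected graph, [r] is the resistance distance exactly when it is
    symmetric, vanishes on the diagonal, and the Laplacian of [r x] at [z]
    equals [2 * (x == z)] up to a term that depends on [z] only
    ([resistance_functionP], [resistance_unique]). A formula for the
    resistances of a graph can thus be verified locally, at one node at a time.

    In the triangulation, a new node hangs between the two ends of its edge by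
    two unit resistors. For currents that enter elsewhere its potential is the
    mean of the potentials of the two ends, and each old edge has conductance
    [1 + q / 2]. So let every node [a] of the triangulation carry a probability
    measure on the old nodes: the Dirac mass for an old node, the uniform
    measure on the two ends for a new one. If [r a b] also denotes the mean of
    [r] under the product of the measures of [a] and [b], and [c a] is [1 / 2]
    for new nodes and [0] for old ones, then the new resistance is
<<
      2 / (q + 2) * r a b + s a + s b - 2 * c a * (a == b),
      s a = c a - r a a / (q + 2)
>>
    ([resistance_function_triangulation]).

    The three indices are sums of resistances weighted by [1] or by the degree
    in either variable. Summing the formula against two weights only requires
    to push the weights forward to the old nodes: the weight [1] becomes
    [1 + q / 2 * degree] and the new degree becomes [(2 * q + 1) * degree], so
    that the three indices of the triangulation are affine functions of the old
    ones. The constant terms involve the sum of the resistances over all edges,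
    which is [n - 1] by Foster's theorem ([foster_edges]).

    The theorem follows by induction on [k] for all graphs at once. As the
    first of [k + 1] steps can be taken first, the closed formula for [k] is
    applied to the triangulation of [G], and what remains is an identity of
    rational functions in which the powers are free variables. *)

(** * Sums over edges and incidences *)

Section Incidence.
Variable G : sgraph.

Lemma edgeP (e : {set G}) :
  reflect (exists u v, adj u v /\ e = [set u; v]) (e \in edges G).
Proof.
apply: (iffP imsetP) => [[[u v] /= uv ->]|[u [v [uv ->]]]].
  by exists u, v; rewrite inE in uv.
by exists (u, v); rewrite ?inE.
Qed.

Lemma adj_neq (u v : G) : adj u v -> u != v.
Proof. by apply: contraTneq => ->; rewrite adj_irr. Qed.

Lemma sum_endpoints (V : nmodType) (u v : G) (F : G -> V) :
  adj u v -> \sum_(x in [set u; v]) F x = F u + F v.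
Proof.
by move=> /adj_neq uv; rewrite big_setU1 ?inE //= big_set1.
Qed.

Lemma sum_incident (V : nmodType) (z : G) (F : {set G} -> V) :
  \sum_(e in edges G | z \in e) F e = \sum_(w | adj z w) F [set z; w].
Proof.
transitivity (\sum_(e in [set [set z; w] | w in [pred w | adj z w]]) F e).
  apply: eq_bigl => e; apply/andP/imsetP => [[/edgeP[u [v [uv ->]]]]|[w zw ->]].
    rewrite !inE => /orP[] /eqP->; first by exists v; rewrite ?inE.
    by exists u; rewrite 1?setUC // inE adj_sym.
  by rewrite !inE eqxx; split=> //; apply/edgeP; exists z, w.
rewrite big_imset //= => w w' zw _ /setP/(_ w).
rewrite !inE eqxx orbT => /esym/orP[] /eqP // wz.
by rewrite wz inE adj_irr in zw.
Qed.

Lemma sum_edge_endpoints (V : nmodType) (F : {set G} -> G -> V) :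
  \sum_(e in edges G) \sum_(u in e) F e u =
  \sum_u \sum_(w | adj u w) F [set u; w] u.
Proof.
rewrite (exchange_big_dep predT) //=.
by apply: eq_bigr => u _; rewrite -(sum_incident u (F^~ u)).
Qed.

Lemma sum_edge_degree (R : pzSemiRingType) (f : G -> R) :
  \sum_(e in edges G) \sum_(u in e) f u = \sum_u (degree u)%:R * f u.
Proof.
rewrite (sum_edge_endpoints (fun=> f)); apply: eq_bigr => u _.
by rewrite sumr_const mulr_natl /degree cardsE.
Qed.

Lemma degree_sum1 (R : pzSemiRingType) (x : G) :
  (degree x)%:R = \sum_(y | adj x y) 1 :> R.
Proof. by rewrite sumr_const /degree cardsE. Qed.

Lemma handshake (R : pzSemiRingType) :
  \sum_(u : G) (degree u)%:R = 2 * #|edges G|%:R :> R.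
Proof.
under eq_bigr do rewrite -[_%:R]mulr1.
rewrite -(sum_edge_degree (fun=> 1)) mulr_natr -sumr_const.
apply: eq_bigr => e /edgeP[u [v [uv ->]]].
by rewrite sum_endpoints // -natrD.
Qed.

End Incidence.

Lemma sum_unordered_pairs (R : pzSemiRingType) (T : finType) (F : T -> T -> R) :
  (forall x, F x x = 0) -> (forall x y, F x y = F y x) ->
  \sum_x \sum_y F x y =
  2 * \sum_(p : T * T | (enum_rank p.1 < enum_rank p.2)%N) F p.1 p.2.
Proof.
move=> F0 FC; rewrite pair_bigA /=.
rewrite (bigID (fun p : T * T => enum_rank p.1 < enum_rank p.2)%N) /=.
rewrite mulr_natl mulr2n; congr (_ + _).
rewrite (bigID (fun p : T * T => p.1 == p.2)) /= big1 ?add0r; last first.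
  by move=> [x y] /= /andP[_ /eqP->].
rewrite (reindex_inj (h := fun p : T * T => (p.2, p.1))) /=; last first.
  by move=> [x y] [x' y'] [-> ->].
apply: eq_big => [[x y]|[x y] _] //=.
by rewrite -leqNgt ltn_neqAle andbC -(inj_eq enum_rank_inj) eq_sym.
Qed.

(** * A local characterisation of resistance distance *)

Section ResistanceFunction.
Variables (R : realFieldType) (G : sgraph).

(** The existentially quantified [h] absorbs whatever does not depend on [x],
    which is what makes explicit candidates for the resistance easy to check. *)
Definition resistance_function (r : G -> G -> R) : Prop :=
  [/\ forall x, r x x = 0, forall x y, r x y = r y x &
      exists h : G -> R, forall x z,
        \sum_(w | adj z w) (r x w - r x z) = 2 * (x == z)%:R + h z].

(** Half the difference of [r y] and [r x] is a unit potential from [x] to [y],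
    since [h] cancels between the two. *)
Lemma resistance_unique (r : G -> G -> R) : connected G ->
  resistance_function r -> forall x y, resistance R x y = r x y.
Proof.
move=> cG [r0 rC [h rh]] x y.
rewrite (resistanceP (v := fun z => (r y z - r x z) / 2)) //.
  by rewrite !r0 (rC y x); lra.
move=> z.
transitivity ((\sum_(w | adj z w) (r x w - r x z) -
               \sum_(w | adj z w) (r y w - r y z)) / 2).
  by rewrite -sumrB mulr_suml; apply: eq_bigr => w _; ring.
by rewrite !rh eq_sym (eq_sym y); field.
Qed.

(** The Laplacian is self-adjoint. *)
Lemma sum_adj_swap (f g : G -> R) :
  \sum_z g z * \sum_(w | adj z w) (f z - f w) =
  \sum_z f z * \sum_(w | adj z w) (g z - g w).
Proof.
have E (a b : G -> R) : \sum_z a z * \sum_(w | adj z w) (b z - b w) =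
    \sum_z \sum_(w | adj z w) a z * b z - \sum_z \sum_(w | adj z w) a z * b w.
  rewrite -sumrB; apply: eq_bigr => z _; rewrite mulr_sumr -sumrB.
  by apply: eq_bigr => w _; rewrite mulrBr.
rewrite !E; congr (_ - _).
  by apply: eq_bigr => z _; apply: eq_bigr => w _; rewrite mulrC.
rewrite (exchange_big_dep predT) //=; apply: eq_bigr => z _.
by apply: eq_big => [w|w _]; rewrite 1?adj_sym // mulrC.
Qed.

Lemma sum_indicator (f : G -> R) (x : G) : \sum_z f z * (z == x)%:R = f x.
Proof.
by rewrite (bigD1 x) //= eqxx mulr1 big1 ?addr0 // => z /negbTE->; rewrite mulr0.
Qed.

(** With one node [o] grounded, the potentials [p x] from [x] to [o] form a
    symmetric Green's function, and [r x y = p x x + p y y - 2 * p x y]. *)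
Lemma resistance_functionP : connected G -> resistance_function (@resistance R G).
Proof.
move=> cG; have [/card_gt0P[o _] _] := andP cG.
pose p x z := potential R x o 0 (enum_rank z) - potential R x o 0 (enum_rank o).
have pP x z : \sum_(w | adj z w) (p x z - p x w) = (z == x)%:R - (z == o)%:R.
  rewrite -(potentialP R x o cG); apply: eq_bigr => w _; rewrite /p; ring.
have po x : p x o = 0 by rewrite /p subrr.
(* Reciprocity: pair the potential of x with the Laplacian of that of y. *)
have pC x y : p x y = p y x.
  have := sum_adj_swap (p x) (p y).
  under eq_bigr do rewrite pP mulrBr.
  under [RHS]eq_bigr do rewrite pP mulrBr.
  by rewrite !sumrB !sum_indicator !po !subr0.
have rE x y : resistance R x y = p x x + p y y - 2 * p x y.
  rewrite (resistanceP (v := fun z => p x z - p y z)) // => [|z].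
    by rewrite (pC y x); ring.
  transitivity (\sum_(w | adj z w) (p x z - p x w) -
                \sum_(w | adj z w) (p y z - p y w)).
    by rewrite -sumrB; apply: eq_bigr => w _; ring.
  by rewrite !pP; ring.
split=> [x|x y|]; [by rewrite rE; ring | by rewrite !rE pC; ring |].
exists (fun z => \sum_(w | adj z w) (p w w - p z z) - 2 * (z == o)%:R) => x z.
transitivity (\sum_(w | adj z w) (p w w - p z z) +
              2 * \sum_(w | adj z w) (p x z - p x w)).
  by rewrite mulr_sumr -big_split; apply: eq_bigr => w _ /=; rewrite !rE; ring.
by rewrite pP eq_sym; ring.
Qed.

End ResistanceFunction.

Section ResistanceSums.
Variables (R : realFieldType) (G : sgraph) (r : G -> G -> R).
Hypotheses (cG : connected G) (rP : resistance_function r).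

(** Foster's theorem, with every edge counted in both directions. At [x = z]
    the defining equation reads [\sum_(w | adj z w) r z w = 2 + h z], while
    summing it over [z] for a fixed [x] kills the Laplacian, so that the sum of
    [h] is [- 2]. *)
Lemma foster : \sum_x \sum_(w | adj x w) r x w = 2 * (#|G|%:R - 1).
Proof.
have [/card_gt0P[o _] _] := andP cG; have [r0 _ [h rh]] := rP.
have hE : \sum_z h z = - 2.
  have := sum_adj_swap (r o) (fun=> 1).
  rewrite [RHS]big1 => [|z _]; last by rewrite big1 ?mulr0 // => w; rewrite subrr.
  under eq_bigr do rewrite mul1r -[\sum_(_ | _) _]opprK -sumrN.
  under eq_bigr do under eq_bigr do rewrite opprB.
  under eq_bigr do rewrite rh.
  rewrite sumrN big_split /= -mulr_sumr.
  have -> : \sum_z (o == z)%:R = 1 :> R.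
    rewrite -[RHS](sum_indicator (fun=> 1) o).
    by apply: eq_bigr => z _; rewrite mul1r eq_sym.
  by move=> ?; lra.
transitivity (\sum_z (2 + h z)).
  apply: eq_bigr => z _; have := rh z z; rewrite eqxx mulr1 => <-.
  by apply: eq_bigr => w _; rewrite r0 subr0.
by rewrite big_split /= hE sumr_const -mulr_natr cardT -cardE; ring.
Qed.

Lemma foster_edges :
  \sum_(e in edges G) \sum_(u in e) \sum_(v in e) r u v = 2 * (#|G|%:R - 1).
Proof.
have [r0 _ _] := rP.
rewrite (sum_edge_endpoints (fun e u => \sum_(v in e) r u v)) -foster.
apply: eq_bigr => u _; apply: eq_bigr => w uw.
by rewrite sum_endpoints // r0 add0r.
Qed.

End ResistanceSums.

(** * The three indices as weighted sums of resistances *)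

Section WeightedSum.
Variables (R : realFieldType) (G : sgraph).
Implicit Types (r : G -> G -> R) (f g : G -> R).

Definition weighted_sum r f g : R := \sum_x \sum_y f x * g y * r x y.

Lemma eq_weighted_sum r r' f g :
  (forall x y, r x y = r' x y) -> weighted_sum r f g = weighted_sum r' f g.
Proof.
by move=> rr; apply: eq_bigr => x _; apply: eq_bigr => y _; rewrite rr.
Qed.

Lemma weighted_sum_lin r (b c b' c' : R) (d : G -> R) :
  (forall x y, r x y = r y x) ->
  weighted_sum r (fun u => b + c * d u) (fun u => b' + c' * d u) =
  b * b' * weighted_sum r (fun=> 1) (fun=> 1)
  + (b * c' + c * b') * weighted_sum r d (fun=> 1)
  + c * c' * weighted_sum r d d.
Proof.
move=> rC; rewrite mulrDl.
have {1}-> : weighted_sum r d (fun=> 1) = weighted_sum r (fun=> 1) d.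
  rewrite {1}/weighted_sum exchange_big; apply: eq_bigr => x _.
  by apply: eq_bigr => y _; rewrite rC; ring.
rewrite !mulr_sumr -!big_split; apply: eq_bigr => x _ /=.
rewrite !mulr_sumr -!big_split; apply: eq_bigr => y _ /=.
ring.
Qed.

Hypothesis cG : connected G.

Let r0 (x : G) : resistance R x x = 0.
Proof. by have [] := resistance_functionP R cG. Qed.

Let rC (x y : G) : resistance R x y = resistance R y x.
Proof. by have [] := resistance_functionP R cG. Qed.

Lemma kirchhoff_sum :
  weighted_sum (@resistance R G) (fun=> 1) (fun=> 1) = 2 * kirchhoff R G.
Proof.
rewrite -(sum_unordered_pairs r0 rC); apply: eq_bigr => x _.
by apply: eq_bigr => y _; ring.
Qed.

Lemma add_degree_kirchhoff_sum :
  weighted_sum (@resistance R G) (fun x => (degree x)%:R) (fun=> 1) =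
  add_degree_kirchhoff R G.
Proof.
pose F x y : R := ((degree x)%:R + (degree y)%:R) * @resistance R G x y.
have := @sum_unordered_pairs R G F.
rewrite -[\sum_(_ | _) F _ _]/(add_degree_kirchhoff R G) => FE.
have : 2 * add_degree_kirchhoff R G =
  2 * weighted_sum (@resistance R G) (fun x => (degree x)%:R) (fun=> 1).
  rewrite -FE; first last.
  - by move=> x y; rewrite /F rC addrC.
  - by move=> x; rewrite /F r0 mulr0.
  rewrite mulr_natl mulr2n {2}/weighted_sum [X in _ + X]exchange_big -big_split.
  apply: eq_bigr => x _; rewrite -big_split /=.
  by apply: eq_bigr => y _; rewrite (rC y) /F; ring.
by move=> ?; lra.
Qed.

Lemma mul_degree_kirchhoff_sum :
  weighted_sum (@resistance R G) (fun x => (degree x)%:R)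
    (fun x => (degree x)%:R) = 2 * mul_degree_kirchhoff R G.
Proof.
pose F x y : R := (degree x)%:R * (degree y)%:R * @resistance R G x y.
rewrite /weighted_sum (@sum_unordered_pairs _ _ F) //.
  by move=> x; rewrite /F r0 mulr0.
by move=> x y; rewrite /F rC; ring.
Qed.

End WeightedSum.

(** * The triangulation and its size *)

Lemma sum_pair_const (R : pzSemiRingType) (I J : finType) (F : I * J -> R)
    (g : I -> R) :
  (forall i j, F (i, j) = g i) -> \sum_p F p = #|J|%:R * \sum_i g i.
Proof.
move=> Fg; transitivity (\sum_i \sum_(j : J) g i).
  by rewrite pair_bigA; apply: eq_bigr => -[i j] _; apply: Fg.
by rewrite mulr_sumr; apply: eq_bigr => i _; rewrite sumr_const mulr_natl.
Qed.

Lemma sum_sig (R : pzSemiRingType) (I : finType) (P : pred I) (g : I -> R) :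
  \sum_(i : {i : I | P i}) g (val i) = \sum_(i | P i) g i.
Proof. by rewrite -(big_sub P g). Qed.

Section TriangulationGraph.
Variables (R : realFieldType) (q : nat) (G : sgraph).
Local Notation T := (triangulation q G).
Implicit Types (f : G -> R) (F : T -> R).

Lemma connected_triangulation : connected G -> connected T.
Proof.
move=> /andP[/card_gt0P[o _] /forallP cG].
have symT : connect_sym (@adj T) by apply/sym_connect_sym/adj_sym.
have old x y : connect (@adj T) (inl x) (inl y).
  have /forallP/(_ y)/connectP[p] := cG x.
  elim: p x => [x _ -> //|z p IHp x /= /andP[xz /IHp zp] /zp].
  exact/connect_trans/connect1.
have new a : connect (@adj T) (inl o) a.
  case: a => [x|[e i]]; first exact: old.
  have /edgeP[u [v [uv eE]]] := valP e.
  apply: connect_trans (old o u) (connect1 _).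
  by rewrite /= eE !inE eqxx.
apply/andP; split; first by apply/card_gt0P; exists (inl o).
apply/forallP => a; apply/forallP => b.
by apply: connect_trans (new b); rewrite symT.
Qed.

Lemma sum_triangulation F (f : G -> R) (g : {set G} -> R) :
    (forall x, F (inl x) = f x) -> (forall e i, F (inr (e, i)) = g (val e)) ->
  \sum_a F a = \sum_x f x + q%:R * \sum_(e in edges G) g e.
Proof.
move=> Ff Fg; rewrite big_sumType /=; congr (_ + _); first exact: eq_bigr.
rewrite (sum_pair_const Fg) card_ord; congr (_ * _).
exact: (sum_sig (fun e => e \in edges G) g).
Qed.

Lemma sum_adj_old (z : G) F (f : G -> R) (g : {set G} -> R) :
    (forall x, F (inl x) = f x) -> (forall e i, F (inr (e, i)) = g (val e)) ->
  \sum_(b | adj (s := T) (inl z) b) F b =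
  \sum_(w | adj z w) (f w + q%:R * g [set z; w]).
Proof.
move=> Ff Fg; rewrite big_mkcond /=.
rewrite (@sum_triangulation _ (fun w => if adj z w then f w else 0)
  (fun e => if z \in e then g e else 0)) => [|x|e i] /=; rewrite ?Ff ?Fg //.
by rewrite -big_mkcond -big_mkcondr sum_incident mulr_sumr -big_split.
Qed.

Lemma sum_adj_new e (i : 'I_q) F :
  \sum_(b | adj (s := T) (inr (e, i)) b) F b = \sum_(u in val e) F (inl u).
Proof.
by rewrite big_sumType /= [X in _ + X]big1 ?addr0 // => -[].
Qed.

Lemma card_edge (e : {e : {set G} | e \in edges G}) : #|val e| = 2%N.
Proof.
by have /edgeP[u [v [/adj_neq uv ->]]] := valP e; rewrite cards2 uv.
Qed.

Lemma degree_old (x : G) :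
  (degree (G := T) (inl x))%:R = (1 + q%:R) * (degree x)%:R :> R.
Proof.
rewrite degree_sum1 (@sum_adj_old _ _ (fun=> 1) (fun=> 1)) //.
by rewrite degree_sum1 mulr_sumr; apply: eq_bigr => w _; ring.
Qed.

Lemma degree_new e (i : 'I_q) : (degree (G := T) (inr (e, i)))%:R = 2 :> R.
Proof. by rewrite degree_sum1 sum_adj_new sumr_const card_edge. Qed.

Lemma card_triangulation : #|T|%:R = #|G|%:R + q%:R * #|edges G|%:R :> R.
Proof.
rewrite -!sum1_card !natr_sum.
exact: (@sum_triangulation _ (fun=> 1) (fun=> 1)).
Qed.

Lemma card_edges_triangulation :
  #|edges T|%:R = (2 * q%:R + 1) * #|edges G|%:R :> R.
Proof.
have := handshake T R.
rewrite (@sum_triangulation _ (fun x => (1 + q%:R) * (degree x)%:R) (fun=> 2));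
  [|exact: degree_old|exact: degree_new].
rewrite -mulr_sumr handshake sumr_const -mulr_natr => E.
by apply: (mulfI (x := 2)); rewrite ?pnatr_eq0 // -E; ring.
Qed.

(** * Resistances in the triangulation *)

(** [anchor a] is the probability measure on the old nodes carried by [a]:
    the hitting distribution on them of a random walk started at [a]. *)
Definition anchor (a : T) (u : G) : R :=
  match a with inl x => (u == x)%:R | inr (e, _) => (u \in val e)%:R / 2 end.

(** The extension of [f] to the new nodes as a harmonic function. *)
Definition spread f (a : T) : R := \sum_u f u * anchor a u.

(** The resistance between a new node and its two ends joined together: two
    unit resistors in parallel. *)
Definition stub (a : T) : R := if a is inr _ then 1 / 2 else 0.

Lemma spread_old f x : spread f (inl x) = f x.
Proof. exact: sum_indicator. Qed.

Lemma spread_new f e (i : 'I_q) :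
  spread f (inr (e, i)) = (\sum_(u in val e) f u) / 2.
Proof.
rewrite mulr_suml [RHS]big_mkcond; apply: eq_bigr => u _ /=.
by case: ifP => _; rewrite ?mul0r ?mulr0 // mul1r.
Qed.

Lemma spread_cst (k : R) a : spread (fun=> k) a = k.
Proof.
case: a => [x|[e i]]; rewrite ?spread_old // spread_new.
by rewrite sumr_const card_edge; field.
Qed.

Lemma spread_lin (k : R) f g a :
  spread (fun u => k * f u + g u) a = k * spread f a + spread g a.
Proof.
by rewrite mulr_sumr -big_split; apply: eq_bigr => u _ /=; ring.
Qed.

Lemma spread_sum (I : finType) (P : pred I) (g : G -> I -> R) a :
  spread (fun u => \sum_(j | P j) g u j) a =
  \sum_(j | P j) spread (g^~ j) a.
Proof.
by rewrite /spread exchange_big /=; apply: eq_bigr => u _; rewrite mulr_suml.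
Qed.

(** Each of the [q] new nodes over an edge carries half of the potential
    difference along the edge, whence the conductance [1 + q / 2]. *)
Lemma spread_adj_old f z :
  \sum_(b | adj (s := T) (inl z) b) (spread f b - spread f (inl z)) =
  (q%:R + 2) / 2 * \sum_(w | adj z w) (f w - f z).
Proof.
rewrite (@sum_adj_old _ _ (fun w => f w - f z)
  (fun e => (\sum_(u in e) f u) / 2 - f z)) => [|x|e i]; first last.
- by rewrite spread_old spread_new.
- by rewrite !spread_old.
rewrite mulr_sumr; apply: eq_bigr => w zw.
by rewrite sum_endpoints //; field.
Qed.

Lemma spread_adj_new f e i :
  \sum_(b | adj (s := T) (inr (e, i)) b) (spread f b - spread f (inr (e, i))) = 0.
Proof.
rewrite sum_adj_new; under eq_bigr do rewrite spread_old.
by rewrite sumrB sumr_const card_edge spread_new; field.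
Qed.

Definition spread2 (r : G -> G -> R) (a b : T) : R :=
  spread (fun u => spread (r u) b) a.

Lemma spread2C r a b : (forall x y, r x y = r y x) -> spread2 r a b = spread2 r b a.
Proof.
move=> rC; rewrite /spread2 /spread.
under eq_bigr do rewrite mulr_suml.
rewrite exchange_big /=; apply: eq_bigr => u _.
by rewrite mulr_suml; apply: eq_bigr => v _; rewrite rC; ring.
Qed.

Definition offset (r : G -> G -> R) (a : T) : R :=
  stub a - spread2 r a a / (q%:R + 2).

Definition triangulation_resistance (r : G -> G -> R) (a b : T) : R :=
  2 / (q%:R + 2) * spread2 r a b + offset r a + offset r b
  - 2 * stub a * (a == b)%:R.

Lemma q2_neq0 : q%:R + 2 != 0 :> R.
Proof. by rewrite -natrD pnatr_eq0 addnC. Qed.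

(** The offsets contribute to the Laplacian in the second variable a term that
    depends on [z] only. Up to such terms, at an old node [z] the spread part
    contributes [2 * anchor a z]. If [a] is old, this is the Dirac term
    required; if [a] is new, it is cancelled by the correction on the diagonal.
    At a new node the spread part is harmonic, and the Dirac term comes from
    the correction alone. *)
Lemma resistance_function_triangulation (r : G -> G -> R) :
  resistance_function r -> resistance_function (triangulation_resistance r).
Proof.
have Q2 := q2_neq0.
move=> [r0 rC [h rh]]; split=> [a|a b|].
- by rewrite /triangulation_resistance /offset eqxx mulr1; field.
- rewrite /triangulation_resistance spread2C // eq_sym.
  by case: eqP => [->|_]; rewrite ?mulr0; ring.
exists (fun z : T => (if z is inl x then h x else 0)
                 + \sum_(b | adj z b) (offset r b - offset r z)) => a z.
have -> : \sum_(b | adj z b)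
      (triangulation_resistance r a b - triangulation_resistance r a z) =
    2 / (q%:R + 2) * spread (fun u =>
      \sum_(b | adj z b) (spread (r u) b - spread (r u) z)) a
    + \sum_(b | adj z b) (offset r b - offset r z)
    - 2 * stub a * (\sum_(b | adj z b) (b == a)%:R
                    - (degree z)%:R * (a == z)%:R).
  rewrite spread_sum degree_sum1 mulr_suml -sumrB !mulr_sumr -sumrN -!big_split.
  apply: eq_bigr => b _ /=.
  have -> : spread (fun u => spread (r u) b - spread (r u) z) a =
      spread2 r a b - spread2 r a z.
    by rewrite /spread2 /spread -sumrB; apply: eq_bigr => u _; ring.
  by rewrite /triangulation_resistance (eq_sym b); ring.
have -> : \sum_(b | adj z b) (b == a)%:R = (adj z a)%:R :> R.
  rewrite -(sum_indicator (fun b => (adj z b)%:R) a) big_mkcond /=.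
  by apply: eq_bigr => b _; case: ifP; rewrite ?mul1r ?mul0r.
case: z => [z|[f j]].
  (* The factor (q + 2) / 2 gained here is the inverse of the coefficient of
     the spread part. *)
  have -> : spread (fun u => \sum_(b | adj (s := T) (inl z) b)
       (spread (r u) b - spread (r u) (inl z))) a =
     (q%:R + 2) / 2 * (2 * anchor a z + h z).
    transitivity (spread (fun u => (q%:R + 2) * (z == u)%:R
                                   + (q%:R + 2) / 2 * h z) a).
      by apply: eq_bigr => u _; rewrite spread_adj_old rh eq_sym; field.
    rewrite spread_lin spread_cst.
    suff -> : spread (fun u => (z == u)%:R) a = anchor a z by field.
    rewrite -(sum_indicator (anchor a) z).
    by apply: eq_bigr => u _; rewrite eq_sym mulrC.
  case: a => [x|[e i]] /=; first by rewrite eq_sym /eq_op /=; field.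
  by rewrite /eq_op /=; field.
have -> : spread (fun u => \sum_(b | adj (s := T) (inr (f, j)) b)
     (spread (r u) b - spread (r u) (inr (f, j)))) a = 0.
  by rewrite -[RHS](spread_cst 0 a); apply: eq_bigr => u _; rewrite spread_adj_new.
case: a => [x|[e i]] /=; first by rewrite /eq_op /=; field.
by rewrite degree_new; field.
Qed.

(** * Weighted sums of resistances in the triangulation *)

(** [nu] is the weight [w] transported along [anchor]; stated by duality, as it
    is only ever integrated against spread functions. *)
Definition pushforward (w : T -> R) (nu : G -> R) : Prop :=
  forall f, \sum_a w a * spread f a = \sum_u nu u * f u.

Lemma weighted_sum_triangulation (r : G -> G -> R) w w' nu nu' :
    pushforward w nu -> pushforward w' nu' ->
  weighted_sum (triangulation_resistance r) w w' =
  2 / (q%:R + 2) * weighted_sum r nu nu'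
  + (\sum_a w a) * (\sum_b w' b * offset r b)
  + (\sum_a w a * offset r a) * (\sum_b w' b)
  - 2 * \sum_a w a * w' a * stub a.
Proof.
move=> wP w'P.
have -> : weighted_sum r nu nu' = weighted_sum (spread2 r) w w'.
  transitivity (\sum_u nu u * \sum_v nu' v * r u v).
    by apply: eq_bigr => u _; rewrite mulr_sumr; apply: eq_bigr => v _; ring.
  rewrite -wP; apply: eq_bigr => a _; under eq_bigr do rewrite -mulrA.
  rewrite -mulr_sumr; congr (_ * _).
  transitivity (spread (fun u => \sum_b w' b * spread (r u) b) a).
    by apply: eq_bigr => u _; rewrite w'P.
  rewrite spread_sum; apply: eq_bigr => b _.
  by rewrite mulr_sumr; apply: eq_bigr => u _; ring.
rewrite !mulr_suml !mulr_sumr -sumrN -!big_split; apply: eq_bigr => a _ /=.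
rewrite -[w a * w' a * stub a](sum_indicator (fun b => w a * w' b * stub a)).
rewrite !mulr_sumr -sumrN -!big_split; apply: eq_bigr => b _ /=.
by rewrite /triangulation_resistance eq_sym; ring.
Qed.

Lemma pushforward1 : pushforward (fun=> 1) (fun u => 1 + q%:R / 2 * (degree u)%:R).
Proof.
move=> f; rewrite (@sum_triangulation _ f (fun e => (\sum_(u in e) f u) / 2))
  => [|x|e i]; rewrite ?mul1r ?spread_old ?spread_new //.
rewrite -mulr_suml sum_edge_degree mulr_suml mulr_sumr -big_split.
by apply: eq_bigr => u _ /=; field.
Qed.

Lemma pushforward_degree :
  pushforward (fun a => (degree a)%:R)
    (fun u => (2 * q%:R + 1) * (degree u)%:R).
Proof.
move=> f; rewrite (@sum_triangulation _
  (fun x => (1 + q%:R) * (degree x)%:R * f x) (fun e => \sum_(u in e) f u))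
  => [|x|e i]; first last.
- by rewrite degree_new spread_new; field.
- by rewrite degree_old spread_old.
rewrite sum_edge_degree mulr_sumr -big_split.
by apply: eq_bigr => u _ /=; ring.
Qed.

(** Offsets vanish at old nodes, where [anchor] is a Dirac mass; at new nodes
    both weights of interest are constant, and Foster's theorem gives the sum. *)
Lemma sum_offset (r : G -> G -> R) (w : T -> R) (k : R) :
  connected G -> resistance_function r ->
  (forall e i, w (inr (e, i)) = k) ->
  \sum_a w a * offset r a =
  k * (q%:R * #|edges G|%:R / 2 - q%:R / 2 / (q%:R + 2) * (#|G|%:R - 1)).
Proof.
have Q2 := q2_neq0; move=> cG rP wk; have [r0 _ _] := rP.
(* One factor 1 / 2 of the coefficient 1 / 4 comes from each variable. *)
rewrite (@sum_triangulation _ (fun=> 0)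
  (fun e => k * (1 / 2 + - (4 * (q%:R + 2))^-1
                           * \sum_(u in e) \sum_(v in e) r u v))) => [|x|e i].
- rewrite big1 // -mulr_sumr big_split /= -[X in k * (_ + X)]mulr_sumr.
  rewrite (foster_edges cG rP).
  by rewrite sumr_const -mulr_natr; field.
- by rewrite /offset /spread2 !spread_old r0 /=; ring.
rewrite /offset /spread2 spread_new wk /=.
under [\sum_(u in val e) spread _ _]eq_bigr do rewrite spread_new.
by rewrite -mulr_suml; field.
Qed.

Lemma sum_stub (w : T -> R) (k : R) : (forall e i, w (inr (e, i)) = k) ->
  \sum_a w a * stub a = k * (q%:R * #|edges G|%:R / 2).
Proof.
move=> wk; rewrite (@sum_triangulation _ (fun=> 0) (fun=> k / 2)) => [|x|e i].
- by rewrite big1 // sumr_const -mulr_natr; field.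
- by rewrite mulr0.
- by rewrite wk /=; ring.
Qed.

Local Notation n := (#|G|%:R : R).
Local Notation m := (#|edges G|%:R : R).
Local Notation Q := (q%:R : R).
Local Notation S := (Q * m / 2 - Q / 2 / (Q + 2) * (n - 1)).

(** The common source of the three recurrences: the weights of the indices are
    constant on new nodes, with value [1] or [2]. *)
Lemma weighted_sum_resistance w w' nu nu' (k k' : R) : connected G ->
    pushforward w nu -> pushforward w' nu' ->
    (forall e i, w (inr (e, i)) = k) -> (forall e i, w' (inr (e, i)) = k') ->
  weighted_sum (@resistance R T) w w' =
  2 / (Q + 2) * weighted_sum (@resistance R G) nu nu'
  + (k' * \sum_a w a + k * \sum_b w' b) * S - k * k' * Q * m.
Proof.
move=> cG wP w'P wk w'k; have rP := resistance_functionP R cG.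
rewrite (eq_weighted_sum _ _ (resistance_unique (connected_triangulation cG)
  (resistance_function_triangulation rP))).
rewrite (weighted_sum_triangulation _ wP w'P) !(sum_offset cG rP wk).
rewrite (sum_offset cG rP w'k) (sum_stub (w := fun a => w a * w' a) (k := k * k')).
  by field; apply: q2_neq0.
by move=> e i; rewrite wk w'k.
Qed.

(** * Recurrences for the three indices *)

Hypothesis cG : connected G.

Let rC (x y : G) : resistance R x y = resistance R y x.
Proof. by have [] := resistance_functionP R cG. Qed.

Let cT : connected T := connected_triangulation cG.

Let sum_degree_triangulation :
  \sum_a (degree (G := T) a)%:R = 2 * ((2 * Q + 1) * m) :> R.
Proof. by rewrite handshake card_edges_triangulation. Qed.

Let sum1_triangulation : \sum_(a : T) 1 = n + Q * m :> R.
Proof. by rewrite sumr_const card_triangulation. Qed.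

Lemma kirchhoff_triangulation :
  kirchhoff R T =
  2 / (Q + 2) * (kirchhoff R G + Q / 2 * add_degree_kirchhoff R G
                 + Q ^+ 2 / 4 * mul_degree_kirchhoff R G)
  + (n + Q * m) * S - Q * m / 2.
Proof.
have Q2 := q2_neq0.
apply: (mulfI (x := 2)); rewrite ?pnatr_eq0 // -kirchhoff_sum //.
rewrite (weighted_sum_resistance cG pushforward1 pushforward1 (k := 1) (k' := 1)) //.
rewrite weighted_sum_lin // kirchhoff_sum // add_degree_kirchhoff_sum //.
by rewrite mul_degree_kirchhoff_sum // sum1_triangulation; field.
Qed.

Lemma add_degree_kirchhoff_triangulation :
  add_degree_kirchhoff R T =
  2 / (Q + 2) * (2 * Q + 1)
    * (add_degree_kirchhoff R G + Q * mul_degree_kirchhoff R G)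
  + 2 * (n + Q * m + (2 * Q + 1) * m) * S - 2 * Q * m.
Proof.
have Q2 := q2_neq0.
rewrite -add_degree_kirchhoff_sum //.
rewrite (weighted_sum_resistance cG pushforward_degree pushforward1
  (k := 2) (k' := 1)) //; last exact: degree_new.
have -> : weighted_sum (@resistance R G)
    (fun u => (2 * Q + 1) * (degree u)%:R) (fun u => 1 + Q / 2 * (degree u)%:R) =
  weighted_sum (@resistance R G)
    (fun u => 0 + (2 * Q + 1) * (degree u)%:R)
    (fun u => 1 + Q / 2 * (degree u)%:R).
  by apply: eq_bigr => x _; apply: eq_bigr => y _; rewrite add0r.
rewrite weighted_sum_lin // kirchhoff_sum // add_degree_kirchhoff_sum //.
rewrite mul_degree_kirchhoff_sum // sum1_triangulation.
by rewrite sum_degree_triangulation; field.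
Qed.

Lemma mul_degree_kirchhoff_triangulation :
  mul_degree_kirchhoff R T =
  2 / (Q + 2) * (2 * Q + 1) ^+ 2 * mul_degree_kirchhoff R G
  + 4 * (2 * Q + 1) * m * S - 2 * Q * m.
Proof.
have Q2 := q2_neq0.
apply: (mulfI (x := 2)); rewrite ?pnatr_eq0 // -mul_degree_kirchhoff_sum //.
rewrite (weighted_sum_resistance cG pushforward_degree pushforward_degree
  (k := 2) (k' := 2)); try exact: degree_new.
have -> : weighted_sum (@resistance R G)
    (fun u => (2 * Q + 1) * (degree u)%:R) (fun u => (2 * Q + 1) * (degree u)%:R) =
  (2 * Q + 1) ^+ 2 * (2 * mul_degree_kirchhoff R G).
  rewrite -mul_degree_kirchhoff_sum // mulr_sumr; apply: eq_bigr => x _.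
  by rewrite mulr_sumr; apply: eq_bigr => y _; ring.
by rewrite sum_degree_triangulation; field.
Qed.

End TriangulationGraph.

(** * The Kirchhoff index of iterated triangulations *)

Theorem theorem12 (R : realFieldType) (G : sgraph) (cG : connected G)
    (q k : nat) (q_gt0 : (1 <= q)%N) :
  let n : R := #|G|%:R in
  let m : R := #|edges G|%:R in
  let Q : R := q%:R in
  let K := kirchhoff R G in
  let Kadd := add_degree_kirchhoff R G in
  let Kmul := mul_degree_kirchhoff R G in
  let a : R := (2 / (Q + 2)) ^+ k in
  kirchhoff R (iter_triangulation q k G) =
    a * K
    + ((2 * (2 * Q + 1) ^+ 2 / (Q + 2)) ^+ k - a)
      * (Kmul / 16 - m ^+ 2 * (Q + 2) / (12 * (2 * Q + 1))
         - m * n / 24 + m * (Q - 1) / (24 * (2 * Q + 1)))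
    + ((2 * (2 * Q + 1) / (Q + 2)) ^+ k - a)
      * (Kadd / 4 - Kmul / 8
         - m ^+ 2 * (Q + 2) * (2 * Q - 1)
           / (6 * (2 * Q + 1) * (2 * Q + 5))
         + m * (2 * n * (Q - 1) - Q + 4) / (12 * (2 * Q + 1))
         - n * (n - 1) / 12)
    + ((2 * Q + 1) ^+ (2 * k)%N - a)
      * (m ^+ 2 * (2 * Q + 3) ^+ 2 / (8 * (2 * Q + 1) * (2 * Q + 5)))
    - ((2 * Q + 1) ^+ k - a)
      * (m * (4 * Q ^+ 2 + 12 * Q + 11) * (m - 2 * n)
           / (12 * (2 * Q + 1) * (2 * Q + 5))
         + m * (4 * Q ^+ 2 + 18 * Q + 23)
           / (12 * (2 * Q + 1) * (2 * Q + 5)))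
    + (a - 1) * ((m - 2 * n) * (m - 2 * n + 2) / 24).
Proof.
move=> /=; have Q0 : 0 <= q%:R :> R by apply: ler0n.
elim: k G cG => [|k IHk] G cG.
  by rewrite muln0 !expr0; ring.
(* Peel off the innermost triangulation, so that the induction hypothesis is
   used for the triangulation of G. *)
rewrite /iter_triangulation iterSr -/(iter_triangulation q k _).
rewrite (IHk _ (connected_triangulation _ cG)).
rewrite card_triangulation card_edges_triangulation.
rewrite kirchhoff_triangulation // add_degree_kirchhoff_triangulation //.
rewrite mul_degree_kirchhoff_triangulation //.
rewrite mulnS exprD !(exprS _ k).
(* The identity is linear in the powers, which can be arbitrary numbers. *)
move: (_ ^+ k) (_ ^+ k) (_ ^+ k) (_ ^+ k) (_ ^+ (2 * k)) => a b c d e.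
field.
apply/and3P; split; apply: lt0r_neq0; lra.
Qed.
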